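(* A pseudo $J$-type algebra $\mathfrak n=\mathfrak n_{-2}\oplus\mathfrak n_{-1}$ with $\dim\mathfrak n_{-2}\geq 3$ satisfying the general $J^2$-condition is rigid.
   Context: A real graded 2-step nilpotent Lie algebra $\mathfrak n=\mathfrak n_{-2}\oplus\mathfrak n_{-1}$ has $[\mathfrak n_{-1},\mathfrak n_{-1}]=\mathfrak n_{-2}$, $\mathfrak n_{-2}$ central and equal to the center of $\mathfrak n$. A real $M$-type algebra is such an $\mathfrak n$ with a non-degenerate symmetric bilinear form $\langle\cdot,\cdot\rangle$ whose restriction to $\mathfrak n_{-2}$ is non-degenerate and with $\mathfrak n_{-2}\perp\mathfrak n_{-1}$. The $J$-map $J\colon\mathfrak n_{-2}\to\operatorname{End}(\mathfrak n_{-1})$ is defined by $\langle J_zx,y\rangle=\langle z,[x,y]\rangle$ for $x,y\in\mathfrak n_{-1}$, $z\in\mathfrak n_{-2}$. It is of pseudo $J$-type if there is an orthonormal basis $z_1,\dots,z_k$ of $\mathfrak n_{-2}$ with $J_{z_i}^2=\pm\mathrm{Id}_{\mathfrak n_{-1}}$ for each $i$. A pseudo $J$-type algebra satisfies the general $J^2$-condition if for every $x\in\mathfrak n_{-1}$ and every pair $z,z'\in\mathfrak n_{-2}$ with $\langle z,z'\rangle=0$ there exists $z''\in\mathfrak n_{-2}$ with $J_zJ_{z'}x=J_{z''}x$. The Tanaka prolongation of $\mathfrak n$ is the maximal graded Lie algebra $\hat{\mathfrak n}=\bigoplus_{i\ge -2}\hat{\mathfrak n}_i$ with negative part equal to $\mathfrak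 n$ such that for $k\ge0$ any $X\in\hat{\mathfrak n}_k$ with $[X,\mathfrak n_{-1}]=0$ is zero; $\mathfrak n$ is rigid if $\hat{\mathfrak n}$ is finite dimensional. *)

(* Defs.v *)
From HB Require Import structures.
From mathcomp Require Import all_boot all_order all_algebra.
From mathcomp Require Import reals.
Set Implicit Arguments. Unset Strict Implicit. Unset Printing Implicit Defensive.
Import Order.TTheory GRing.Theory Num.Theory.
Local Open Scope ring_scope.

(* n_{-1} = 'rV[R]_m, n_{-2} = 'rV[R]_k, bracket brk : n_{-1} x n_{-1} -> n_{-2}. *)

Definition graded_2step (R : nzRingType) (m k : nat)
    (brk : 'rV[R]_m -> 'rV[R]_m -> 'rV[R]_k) : Prop :=
  [/\
      (forall (c : R) x x' y, brk (c *: x + x') y = c *: brk x y + brk x' y),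
      (forall (c : R) x y y', brk x (c *: y + y') = c *: brk x y + brk x y'),
      (forall x, brk x x = 0),
      (forall z, exists s : seq ('rV[R]_m * 'rV[R]_m),
          z = \sum_(p <- s) brk p.1 p.2) &
      (* the center of n is exactly n_{-2}: an element x + z is central iff x = 0 *)
      (forall x, (forall y, brk x y = 0) -> x = 0)].

Definition formG (R : nzRingType) (n : nat) (G : 'M[R]_n) (u v : 'rV[R]_n) : R :=
  (u *m G *m v^T) 0 0.

Definition inj1 (R : nzRingType) (m k : nat) (x : 'rV[R]_m) : 'rV[R]_(m + k) :=
  row_mx x 0.
Definition inj2 (R : nzRingType) (m k : nat) (z : 'rV[R]_k) : 'rV[R]_(m + k) :=
  row_mx 0 z.

Definition Mtype_form (R : nzRingType) (m k : nat) (G : 'M[R]_(m + k)) : Prop :=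
  [/\ (forall u v, formG G u v = formG G v u),
      (forall u, (forall v, formG G u v = 0) -> u = 0),
      (forall z : 'rV[R]_k,
          (forall z', formG G (inj2 m z) (inj2 m z') = 0) -> z = 0) &
      (forall (x : 'rV[R]_m) (z : 'rV[R]_k),
          formG G (inj1 k x) (inj2 m z) = 0)].

Definition Jmap (R : nzRingType) (m k : nat) (G : 'M[R]_(m + k))
    (brk : 'rV[R]_m -> 'rV[R]_m -> 'rV[R]_k)
    (J : 'rV[R]_k -> 'rV[R]_m -> 'rV[R]_m) : Prop :=
  forall z x y, formG G (inj1 k (J z x)) (inj1 k y) = formG G (inj2 m z) (inj2 m (brk x y)).

Definition pseudo_Jtype (R : fieldType) (m k : nat) (G : 'M[R]_(m + k))
    (J : 'rV[R]_k -> 'rV[R]_m -> 'rV[R]_m) : Prop :=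
  exists zb : 'I_k -> 'rV[R]_k,
    [/\ \rank (\matrix_(i < k, j < k) zb i 0 j) = k,
        (forall i j, i != j -> formG G (inj2 m (zb i)) (inj2 m (zb j)) = 0),
        (forall i, formG G (inj2 m (zb i)) (inj2 m (zb i)) = 1 \/
                   formG G (inj2 m (zb i)) (inj2 m (zb i)) = -1) &
        (forall i, (forall x, J (zb i) (J (zb i) x) = x) \/
                   (forall x, J (zb i) (J (zb i) x) = - x))].

Definition general_J2 (R : nzRingType) (m k : nat) (G : 'M[R]_(m + k))
    (J : 'rV[R]_k -> 'rV[R]_m -> 'rV[R]_m) : Prop :=
  forall (x : 'rV[R]_m) (z z' : 'rV[R]_k),
    formG G (inj2 m z) (inj2 m z') = 0 ->
    exists z'' : 'rV[R]_k, J z (J z' x) = J z'' x.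

(** * Tanaka prolongation (explicit standard construction)
   An element of degree p of the prolongation is represented as:
   E2 z (p = -2), E1 x (p = -1), or, for p >= 0, EP f g where
   f : n_{-1} -> \hat n_{p-1} and g : n_{-2} -> \hat n_{p-2} are its
   actions ad(X)|_{n_{-1}}, ad(X)|_{n_{-2}}  (i.e. [X, y] = f y, [X, z] = g z). *)
Inductive El (R : Type) (m k : nat) : Type :=
| E2 : 'rV[R]_k -> El R m k
| E1 : 'rV[R]_m -> El R m k
| EP : ('rV[R]_m -> El R m k) -> ('rV[R]_k -> El R m k) -> El R m k.

Section Prolongation.
Variables (R : nzRingType) (m k : nat).
Local Notation El := (El R m k).

Fixpoint elEq (A B : El) {struct A} : Prop :=
  match A, B with
  | E2 a, E2 b => a = b
  | E1 a, E1 b => a = b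
  | EP f g, EP f' g' =>
      (forall x, elEq (f x) (f' x)) /\ (forall z, elEq (g z) (g' z))
  | _, _ => False
  end.

Fixpoint elAdd (A B : El) {struct A} : El :=
  match A, B with
  | E2 a, E2 b => E2 _ (a + b)
  | E1 a, E1 b => E1 _ (a + b)
  | EP f g, EP f' g' =>
      EP (fun x => elAdd (f x) (f' x)) (fun z => elAdd (g z) (g' z))
  | _, _ => A
  end.

Fixpoint elScale (c : R) (A : El) {struct A} : El :=
  match A with
  | E2 a => E2 _ (c *: a)
  | E1 a => E1 _ (c *: a)
  | EP f g => EP (fun x => elScale c (f x)) (fun z => elScale c (g z))
  end.

Definition elOpp (A : El) : El := elScale (-1) A.

Fixpoint isZero (A : El) : Prop :=
  match A with
  | E2 a => a = 0
  | E1 a => a = 0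
  | EP f g => (forall x, isZero (f x)) /\ (forall z, isZero (g z))
  end.

Variable brk : 'rV[R]_m -> 'rV[R]_m -> 'rV[R]_k.

(* [A, y] for y in n_{-1}; the first branch (degree -3) is never used *)
Definition actY (A : El) (y : 'rV[R]_m) : El :=
  match A with
  | E2 _ => E2 _ 0
  | E1 a => E2 _ (brk a y)
  | EP f _ => f y
  end.

(* [A, z] for z in n_{-2}, A of degree >= 0 (other branches never used) *)
Definition actZ (A : El) (z : 'rV[R]_k) : El :=
  match A with
  | EP _ g => g z
  | _ => E2 _ 0
  end.

Definition linE (n : nat) (f : 'rV[R]_n -> El) : Prop :=
  forall (c : R) u v, elEq (f (c *: u + v)) (elAdd (elScale c (f u)) (f v)).

(* prol j A  <->  A is an element of \hat n_{j-2} *)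
Fixpoint prol (j : nat) (A : El) {struct j} : Prop :=
  match j with
  | 0 => exists z, A = E2 _ z
  | S j1 =>
    match j1 with
    | 0 => exists x, A = E1 _ x
    | S j' =>
      exists f g, A = EP f g /\ linE f /\ linE g /\
        (forall x, prol j1 (f x)) /\ (forall z, prol j' (g z)) /\
        (* X[x,y] = [Xx,y] + [x,Xy] *)
        (forall x y, elEq (g (brk x y)) (elAdd (actY (f x) y) (elOpp (actY (f y) x)))) /\
        (* 0 = X[x,z] = [Xx,z] + [x,Xz]   (only meaningful in degree >= 1) *)
        ((0 < j')%N -> forall x z, elEq (actZ (f x) z) (actY (g z) x)) /\
        (* 0 = X[z,z'] = [Xz,z'] + [z,Xz'] (only meaningful in degree >= 2) *)
        ((1 < j')%N -> forall z z', elEq (actZ (g z) z') (actZ (g z') z))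
    end
  end.

(* rigid: \hat n is finite dimensional, i.e. \hat n_p = 0 for all large p
   (each \hat n_p is automatically finite dimensional) *)
Definition rigid : Prop :=
  exists N : nat, forall j, (N <= j)%N -> forall A, prol j A -> isZero A.

End Prolongation.

(* Main.v *)
(** In the prolongation the component of degree 3 vanishes, and then so do all higher
    ones.  Let [z_i] be the orthonormal basis and [J_i = J_{z_i}].  Pairing
    [J_i J_j x = J_{z''} x] with [x] gives [0], so [J_i J_j] is skew and the [J_i]
    anticommute.

    - Degree 0: for a derivation acting on [n_{-2}] by [B], [<z_i, z_i> <B z_i, z_i>]
      does not depend on [i].
    - Degree 1: if [Y] kills [n_{-2}], then [(x, y) |-> [[Y, x], y]] is symmetric and
      commutes in each variable with all [J_i J_j], hence vanishes as [dim n_{-2} >= 3];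
      so [Y = 0].  In general the degree 0 statement applied to [[Y, x]] shows that
      [<z_i, z_i> J_i [Y, z_i]] does not depend on [i].
    - Degree 3: [S_ij = [[X, z_i], z_j]] is symmetric and, for fixed [i],
      [<z_j, z_j> J_j S_ij] does not depend on [j]; with three anticommuting [J]'s this
      forces [S = 0], so [[X, n_{-2}] = 0] and then [X = 0] by the degree 1 case. *)
Require Import Defs.
From mathcomp Require Import all_boot all_order all_algebra.
From mathcomp Require Import reals.
From mathcomp Require Import ring.

Set Implicit Arguments. Unset Strict Implicit. Unset Printing Implicit Defensive.
Import Order.TTheory GRing.Theory Num.Theory.
Local Open Scope ring_scope.

(** * Anticommuting skew maps on a space with a non-degenerate symmetric form *)

Section SkewClifford.
Variables (R : realFieldType) (V : lmodType R) (k : nat).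
Variables (b : V -> V -> R) (J : 'I_k -> V -> V) (e : 'I_k -> R).
Hypothesis b_linl : forall c x x' y, b (c *: x + x') y = c * b x y + b x' y.
Hypothesis bC : forall x y, b x y = b y x.
Hypothesis b_nondeg : forall x, (forall y, b x y = 0) -> x = 0.
Hypothesis J_skew : forall i x y, b (J i x) y = - b x (J i y).
Hypothesis J_anti : forall i j, i != j -> forall x, J i (J j x) = - J j (J i x).
Hypothesis J_sqr : forall i x, J i (J i x) = e i *: x.
Hypothesis e_sqr : forall i, e i * e i = 1.

Lemma form0l y : b 0 y = 0.
Proof. by have := b_linl (-1) 0 0 y; rewrite scaler0 addr0 mulN1r addNr. Qed.

Lemma formZl c x y : b (c *: x) y = c * b x y.
Proof. by rewrite -[c *: x]addr0 b_linl form0l addr0. Qed.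

Lemma formDl x x' y : b (x + x') y = b x y + b x' y.
Proof. by rewrite -{1}[x]scale1r b_linl mul1r. Qed.

Lemma formNl x y : b (- x) y = - b x y.
Proof. by rewrite -scaleN1r formZl mulN1r. Qed.

Lemma formNr x y : b x (- y) = - b x y.
Proof. by rewrite bC formNl bC. Qed.

Lemma formZr c x y : b x (c *: y) = c * b x y.
Proof. by rewrite bC formZl bC. Qed.

Lemma form_inj x x' : (forall y, b x y = b x' y) -> x = x'.
Proof.
move=> h; apply/eqP; rewrite -subr_eq0; apply/eqP/b_nondeg => y.
by rewrite formDl formNl h subrr.
Qed.

Lemma skewZ i c x : J i (c *: x) = c *: J i x.
Proof. by apply: form_inj => y; rewrite J_skew !formZl J_skew mulrN. Qed.

Lemma skewN i x : J i (- x) = - J i x.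
Proof. by rewrite -scaleN1r skewZ scaleN1r. Qed.

Lemma skew0 i : J i 0 = 0.
Proof. by have := skewZ i 0 0; rewrite !scale0r. Qed.

Lemma skew_eq0 i x : J i x = 0 -> x = 0.
Proof.
by move=> h; rewrite -[x]scale1r -(e_sqr i) -scalerA -[e i *: x]J_sqr h skew0 scaler0.
Qed.

Lemma skew_isom i x y : b (J i x) (J i y) = - e i * b x y.
Proof. by rewrite J_skew J_sqr formZr mulNr. Qed.

Lemma eq_opp0 (x : V) : x = - x -> x = 0.
Proof.
move=> h; have : 2%:R *: x = 0 by rewrite scaler_nat mulr2n {1}h addNr.
by move/eqP; rewrite scaler_eq0 pnatr_eq0 => /eqP.
Qed.

(** The hypothesis makes [- J i a (J i)^-1] the adjoint of [a] for every [i]. Comparing two indices,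
    [a] commutes with [(J j)^-1 J i], which is [J i J j] up to sign. *)
Lemma comm_even (a : V -> V) :
  (forall i x y, b (a x) (J i y) = b (J i x) (a y)) ->
  forall i j, i != j -> forall x, a (J i (J j x)) = J i (J j (a x)).
Proof.
move=> ha i j ij x; apply: form_inj => y.
have -> : y = e j *: J j (J j y) by rewrite J_sqr scalerA e_sqr scale1r.
rewrite !formZr; congr (_ * _).
transitivity (- e j * b (J i x) (a (J j y))).
  by rewrite ha [J j (J i _)]J_anti 1?eq_sym// J_sqr skewZ formNl formZl mulNr.
by rewrite -ha [J i (J j (a x))]J_anti // formNl skew_isom J_skew mulrN opprK.
Qed.

(* [T] is bilinear over [P = J_0 J_1] and [Q = J_0 J_2], so [T (P x) (Q y)] equals both
   [P Q T x y] and [Q P T x y], while [P Q = - Q P] is invertible. *)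
Lemma sym_comm_even_eq0 (T : V -> V -> V) :
  (2 < k)%N -> (forall x y, T x y = T y x) ->
  (forall i j, i != j -> forall x y, T x (J i (J j y)) = J i (J j (T x y))) ->
  forall x y, T x y = 0.
Proof.
move=> k3 TC Tc x y.
have k2 : (1 < k)%N by apply: ltn_trans k3.
have k1 : (0 < k)%N by apply: ltn_trans k2.
pose i0 := Ordinal k1; pose i1 := Ordinal k2; pose i2 := Ordinal k3.
have n01 : i0 != i1 by []. have n02 : i0 != i2 by []. have n12 : i1 != i2 by [].
have h1 : T (J i0 (J i1 x)) (J i0 (J i2 y)) = J i0 (J i2 (J i0 (J i1 (T x y)))).
  by rewrite Tc // TC Tc // TC.
have h2 : T (J i0 (J i1 x)) (J i0 (J i2 y)) = J i0 (J i1 (J i0 (J i2 (T x y)))).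
  by rewrite TC Tc // TC Tc.
have : J i0 (J i1 (J i0 (J i2 (T x y)))) = - J i0 (J i1 (J i0 (J i2 (T x y)))).
  rewrite -{1}h2 h1 (J_anti (i := i2)) // (J_anti (i := i1) (j := i0)) //.
  by rewrite (J_anti (i := i2)) // !skewN !opprK.
by move/eq_opp0 /skew_eq0 /skew_eq0 /skew_eq0 /skew_eq0.
Qed.

(* Evaluate [s] at [J_i J_j] and [J_j J_i], which agree up to sign. *)
Lemma weights_equal (s : V -> V -> R) (rho : 'I_k -> R) :
  (forall x y, s (- x) (- y) = s x y) ->
  (forall i x y, s (J i x) (J i y) = e i * (s x y - 2 * rho i * b x y)) ->
  forall i j, i != j -> forall x y, (rho i - rho j) * b x y = 0.
Proof.
move=> sN hs i j ij x y.
have : s (J i (J j x)) (J i (J j y)) = s (J j (J i x)) (J j (J i y)).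
  by rewrite J_anti // [J i (J j y)]J_anti // sN.
rewrite !hs !skew_isom => /eqP; rewrite -subr_eq0.
have -> : e i * (e j * (s x y - 2 * rho j * b x y) - 2 * rho i * (- e j * b x y)) -
  e j * (e i * (s x y - 2 * rho i * b x y) - 2 * rho j * (- e i * b x y)) =
  4 * (e i * e j) * ((rho i - rho j) * b x y) by ring.
rewrite mulf_eq0 => /orP[|/eqP //]; rewrite mulf_eq0 pnatr_eq0 /= => /eqP h.
have : (e i * e i) * (e j * e j) = 0 by rewrite mulrACA h mul0r.
by rewrite !e_sqr mulr1 => /eqP; rewrite oner_eq0.
Qed.

Lemma third_ord (i j : 'I_k) : (2 < k)%N -> exists r, r != i /\ r != j.
Proof.
move=> k3; have : (0 < #|~: [set i; j]|)%N.
  by rewrite cardsCs setCK card_ord cards2 subn_gt0; case: (i != j) => //; apply: ltnW.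
case/card_gt0P => r; rewrite !inE negb_or => /andP[ri rj]; by exists r.
Qed.

(* [S i j] will be [[X, z_i], z_j] for [X] of degree 3, and [c i] will be [<z_i, z_i>]. *)
Lemma sym_proportional_eq0 (S : 'I_k -> 'I_k -> V) (c : 'I_k -> R) :
  (2 < k)%N -> (forall i, c i * c i = 1) -> (forall i j, S i j = S j i) ->
  (forall i j r, c j *: J j (S i j) = c r *: J r (S i r)) ->
  forall i j, S i j = 0.
Proof.
move=> k3 c_sqr SC Sc.
(* By [Sc] the vector [c j *: J j (S i j)] depends on [i] alone; [l i] is its common value, so that
   [S] is recovered from [l]. *)
pose l i := c i *: J i (S i i).
pose d i := c i * e i.
have d_sqr i : d i * d i = 1 by rewrite mulrACA c_sqr e_sqr mulr1.
have Sl i j : S i j = d j *: J j (l i).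
  rewrite /l (Sc i i j) skewZ J_sqr !scalerA.
  by rewrite -mulrA -/(d j) d_sqr scale1r.
have lC i j : J i (l j) = (d i * d j) *: J j (l i).
  rewrite -scalerA -Sl SC Sl scalerA d_sqr scale1r //.
clearbody l; suff l0 i : l i = 0 by move=> i j; rewrite Sl l0 skew0 scaler0.
have [j [ji _]] := third_ord i i k3.
have [r [ri rj]] := third_ord i j k3.
apply: (@skew_eq0 j); apply: (@skew_eq0 r); apply: eq_opp0.
(* Three uses of [lC] take the index of [l] round the cycle i, j, r, i, with two anticommutations in
   between. Their signs cancel, so [J r (J j (l i))] turns into [J j (J r (l i))], its own opposite;
   the scalars multiply to 1. *)
rewrite -(J_anti (i := j) (j := r)) 1?eq_sym// {1}(lC j i) skewZ (J_anti ri).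
rewrite (lC r j) skewZ (J_anti (i := i) (j := j)) 1?eq_sym// (lC i r) !skewZ.
rewrite !scalerN opprK !scalerA.
have -> : d j * d i * (d r * d j) * (d i * d r) = (d j * d j) * (d i * d i) * (d r * d r) by ring.
by rewrite !d_sqr !mulr1 scale1r.
Qed.

End SkewClifford.

(** * Vanishing in the Tanaka prolongation; [prol j] is the component of degree j - 2 *)

Section ProlongationFacts.
Variables (R : nzRingType) (m k : nat) (brk : 'rV[R]_m -> 'rV[R]_m -> 'rV[R]_k).
Local Notation El := (El R m k).
Implicit Types A B : El.

(** Coordinates in degrees -1 and -2. Below they are taken only of elements of [prol 1] and
    [prol 0], so the default 0 is never reached. *)
Definition vec1 A : 'rV[R]_m := if A is E1 x then x else 0.
Definition vec2 A : 'rV[R]_k := if A is E2 z then z else 0.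

Lemma elEq_isZero A B : elEq A B -> isZero B -> isZero A.
Proof.
elim: A B => [a|a|f IHf g IHg] [b|b|f' g'] //=; try by move=> ->.
move=> [hf hg] [zf zg]; split => x; first exact: IHf (hf x) (zf x).
exact: IHg (hg x) (zg x).
Qed.

Lemma isZero_add A B : isZero A -> isZero B -> isZero (elAdd A B).
Proof.
elim: A B => [a|a|f IHf g IHg] [b|b|f' g'] //=; try by move=> -> ->; rewrite addr0.
move=> [zf zg] [zf' zg']; split => x; first exact: IHf (zf x) (zf' x).
exact: IHg (zg x) (zg' x).
Qed.

Lemma isZero_scale c A : isZero A -> isZero (elScale c A).
Proof.
elim: A => [a|a|f IHf g IHg] //=; try by move=> ->; rewrite scaler0.
by move=> [zf zg]; split => x; [apply: IHf | apply: IHg].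
Qed.

Hypothesis brk_linl : forall c x x' y, brk (c *: x + x') y = c *: brk x y + brk x' y.
Hypothesis brk_alt : forall x, brk x x = 0.
Hypothesis brk_span :
  forall z, exists s : seq ('rV[R]_m * 'rV[R]_m), z = \sum_(p <- s) brk p.1 p.2.

Lemma brk0l y : brk 0 y = 0.
Proof. by have := brk_linl (-1) 0 0 y; rewrite scaler0 addr0 scaleN1r addNr. Qed.

Lemma isZero_actY A y : isZero A -> isZero (actY brk A y).
Proof. by case: A => [a|a|f g] //= => [-> | [+ _]]; [apply: brk0l | apply]. Qed.

Lemma isZero_actZ A z : isZero A -> isZero (actZ A z).
Proof. by case: A => [a|a|f g] //= [_]; apply. Qed.

Lemma prolSS j A : prol brk j.+2 A ->
  [/\ linE (actY brk A), linE (actZ A),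
      forall x, prol brk j.+1 (actY brk A x) & forall z, prol brk j (actZ A z)] /\
  [/\ forall x y, elEq (actZ A (brk x y))
        (elAdd (actY brk (actY brk A x) y) (elOpp (actY brk (actY brk A y) x))),
      (0 < j)%N -> forall x z, elEq (actZ (actY brk A x) z) (actY brk (actZ A z) x) &
      (1 < j)%N -> forall z z', elEq (actZ (actZ A z) z') (actZ (actZ A z') z)].
Proof. by move=> [f [g [-> [? [? [? [? [? [? ?]]]]]]]]]. Qed.

Lemma prol1E A : prol brk 1 A -> A = E1 k (vec1 A).
Proof. by case=> x ->. Qed.

Lemma prol0E A : prol brk 0 A -> A = E2 m (vec2 A).
Proof. by case=> x ->. Qed.

Lemma prol2_derivation A : prol brk 2 A -> exists a b,
  [/\ forall x, actY brk A x = E1 k (a x), forall z, actZ A z = E2 m (b z),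
      forall c x x', a (c *: x + x') = c *: a x + a x',
      forall c z z', b (c *: z + z') = c *: b z + b z' &
      forall x y, b (brk x y) = brk (a x) y - brk (a y) x].
Proof.
move=> /prolSS [[ylin zlin py pz] [lb _ _]].
have yE x := prol1E (py x); have zE z := prol0E (pz z).
exists (fun x => vec1 (actY brk A x)), (fun z => vec2 (actZ A z)); split => //.
- by move=> c x x'; have := ylin c x x'; rewrite yE (yE x) (yE x').
- by move=> c z z'; have := zlin c z z'; rewrite zE (zE z) (zE z').
- move=> x y; have := lb x y.
  by rewrite zE (yE x) (yE y) /= scaleN1r.
Qed.

(** The brackets of n_{-1} span n_{-2}, and the derivation rule gives the action on each bracket
    from the action on n_{-1}. *)
Lemma prol_isZero_of_actY j A :
  prol brk j.+2 A -> (forall x, isZero (actY brk A x)) -> isZero A.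
Proof.
move=> [f [g [-> [_ [glin [_ [_ [fg _]]]]]]]] /= zf; split => //.
have zg x y : isZero (g (brk x y)).
  apply: elEq_isZero (fg x y) _; apply: isZero_add; first exact/isZero_actY/zf.
  exact/isZero_scale/isZero_actY/zf.
move=> z; have [s ->] := brk_span z.
elim: s => [|p s IHs]; first by rewrite big_nil -(brk_alt 0).
rewrite big_cons -[brk _ _]scale1r; apply: elEq_isZero (glin _ _ _) _.
by apply: isZero_add IHs; apply: isZero_scale.
Qed.

(** An element one degree higher sends n_{-1} into a component already known to vanish. *)
Lemma prol_isZero_above N :
  (forall A, prol brk N.+2 A -> isZero A) ->
  forall j, (N.+2 <= j)%N -> forall A, prol brk j A -> isZero A.
Proof.
move=> zN j /subnK <-; elim: (j - N.+2)%N => [|d IHd] A; first exact: zN.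
rewrite addSn addnS => pA; apply: (prol_isZero_of_actY pA) => x.
have [f [g [-> [_ [_ [pf _]]]]]] := pA.
by apply: IHd; rewrite addnS; apply: pf.
Qed.

End ProlongationFacts.

(** * Bilinearity of the form of a matrix *)

Section FormG.
Variables (R : comNzRingType) (n : nat) (G : 'M[R]_n).

Lemma formG_linl c u u' v : formG G (c *: u + u') v = c * formG G u v + formG G u' v.
Proof. by rewrite /formG !mulmxDl -!scalemxAl !mxE. Qed.

Lemma formG_linr c u v v' : formG G u (c *: v + v') = c * formG G u v + formG G u v'.
Proof. by rewrite /formG linearP mulmxDr -scalemxAr !mxE. Qed.

End FormG.

(** * The orthonormal basis of n_{-2} and its anticommuting maps J_i *)

Section PseudoJ.
Variables (R : realFieldType) (m k : nat) (brk : 'rV[R]_m -> 'rV[R]_m -> 'rV[R]_k).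
Variables (G : 'M[R]_(m + k)) (J : 'rV[R]_k -> 'rV[R]_m -> 'rV[R]_m).
Variable zb : 'I_k -> 'rV[R]_k.
Hypothesis brk_graded : graded_2step brk.
Hypothesis G_M : Mtype_form G.
Hypothesis J_G : Jmap G brk J.
Hypothesis zb_rank : \rank (\matrix_(i < k, j < k) zb i 0 j) = k.
Hypothesis zb_orth : forall i j, i != j -> formG G (inj2 m (zb i)) (inj2 m (zb j)) = 0.
Hypothesis zb_norm : forall i, formG G (inj2 m (zb i)) (inj2 m (zb i)) = 1 \/
  formG G (inj2 m (zb i)) (inj2 m (zb i)) = -1.
Variable e : 'I_k -> R.
Hypothesis e_sqr : forall i, e i * e i = 1.
Hypothesis J_zb : forall i x, J (zb i) (J (zb i) x) = e i *: x.
Hypothesis J_J2 : general_J2 G J.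
Hypothesis k_gt2 : (2 < k)%N.

Let f1 (x y : 'rV[R]_m) := formG G (inj1 k x) (inj1 k y).
Let f2 (z z' : 'rV[R]_k) := formG G (inj2 m z) (inj2 m z').
Let Jb i := J (zb i).
Let h i := f2 (zb i) (zb i).

Lemma form1_linl c x x' y : f1 (c *: x + x') y = c * f1 x y + f1 x' y.
Proof. by rewrite /f1 -formG_linl /inj1 scale_row_mx add_row_mx scaler0 addr0. Qed.

Lemma form1C x y : f1 x y = f1 y x.
Proof. by case: G_M => + _ _ _; apply. Qed.

Lemma form1_nondeg x : (forall y, f1 x y = 0) -> x = 0.
Proof.
case: G_M => _ nd _ orth hx; have : inj1 k x = 0.
  apply: nd => v; rewrite -[v]hsubmxK.
  have -> : row_mx (lsubmx v) (rsubmx v) = 1 *: inj1 k (lsubmx v) + inj2 m (rsubmx v).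
    by rewrite scale1r /inj1 /inj2 add_row_mx addr0 add0r.
  by rewrite formG_linr orth mul1r addr0; apply: hx.
by rewrite /inj1 -(row_mx0 R 1 m k) => /eq_row_mx [].
Qed.

Lemma form2_linr c z u u' : f2 z (c *: u + u') = c * f2 z u + f2 z u'.
Proof. by rewrite /f2 -formG_linr /inj2 scale_row_mx add_row_mx scaler0 addr0. Qed.

Lemma form2_0r z : f2 z 0 = 0.
Proof. by have := form2_linr (-1) z 0 0; rewrite scaler0 addr0 mulN1r addNr. Qed.

Lemma form2_sumr z (c : 'I_k -> R) (v : 'I_k -> 'rV[R]_k) :
  f2 z (\sum_i c i *: v i) = \sum_i c i * f2 z (v i).
Proof.
by elim/big_rec2: _ => [|i x y _ <-]; [exact: form2_0r | exact: form2_linr].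
Qed.

Lemma zb_norm_sqr i : h i * h i = 1.
Proof. by rewrite /h /f2; case: (zb_norm i) => ->; rewrite ?mulrNN mulr1. Qed.

(** Since [h i] is its own inverse, the vectors [h i *: zb i] form the dual basis. *)
Lemma zb_expand u : u = \sum_i (h i * f2 (zb i) u) *: zb i.
Proof.
have [c uE] : exists c : 'I_k -> R, u = \sum_i c i *: zb i.
  set M := (\matrix_(i < k, j < k) zb i 0 j).
  have Mu : M \in unitmx by rewrite -row_full_unit /row_full zb_rank.
  exists ((u *m invmx M) 0); rewrite -[LHS](mulmxKV Mu) mulmx_sum_row.
  apply: eq_bigr => i _; congr (_ *: _); apply/rowP => j; by rewrite !mxE.
rewrite {1}uE; apply: eq_bigr => i _; congr (_ *: _).
rewrite uE form2_sumr (bigD1 i) //= big1 ?addr0 => [|j ji].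
  by rewrite mulrCA zb_norm_sqr mulr1.
by rewrite /f2 zb_orth ?mulr0 // eq_sym.
Qed.

Lemma brk_skew x y : brk x y = - brk y x.
Proof.
case: brk_graded => bl br ba _ _.
have := ba (1 *: x + y); rewrite bl br br !ba scale1r scaler0 add0r addr0.
by move/eqP; rewrite addr_eq0 scale1r => /eqP.
Qed.

Lemma Jb_form i x y : f1 (Jb i x) y = f2 (zb i) (brk x y).
Proof. exact: J_G. Qed.

Lemma form2N z u : f2 z (- u) = - f2 z u.
Proof. by rewrite -[- u]addr0 -scaleN1r form2_linr form2_0r addr0 mulN1r. Qed.

Lemma Jb_skew i x y : f1 (Jb i x) y = - f1 x (Jb i y).
Proof. by rewrite [f1 x _]form1C !Jb_form brk_skew form2N. Qed.

Lemma Jb_anti i j : i != j -> forall x, Jb i (Jb j x) = - Jb j (Jb i x).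
Proof.
move=> ij x.
(* The pairing is <J_{z''} y, y> = <z'', [y, y]>. Polarising it below at [x + y] gives skewness of
   [Jb i] composed with [Jb j]. *)
have alt y : f1 (Jb i (Jb j y)) y = 0.
  have [z Ez] := J_J2 y (zb_orth ij); rewrite /Jb Ez.
  by case: brk_graded => _ _ ba _ _; rewrite /f1 J_G ba; apply: form2_0r.
have JbD l y y' : Jb l (y + y') = Jb l y + Jb l y'.
  apply: (form_inj form1_linl form1_nondeg) => w.
  by rewrite (formDl form1_linl) !Jb_skew (formDl form1_linl) opprD.
apply: (form_inj form1_linl form1_nondeg) => y.
have form1Dr u v w : f1 u (v + w) = f1 u v + f1 u w.
  by rewrite ![f1 u _]form1C (formDl form1_linl).
have := alt (x + y); rewrite !JbD !(formDl form1_linl) !form1Dr !alt add0r addr0.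
move=> /eqP; rewrite addr_eq0 => /eqP ->; rewrite (formNl form1_linl); congr (- _).
by rewrite Jb_skew Jb_skew opprK form1C.
Qed.

(** * Degree 0: derivations *)

Lemma derivation_form (a : 'rV[R]_m -> 'rV[R]_m) (b : 'rV[R]_k -> 'rV[R]_k) i x y :
  b (brk x y) = brk (a x) y - brk (a y) x ->
  f2 (zb i) (b (brk x y)) = f1 (Jb i (a x)) y + f1 (Jb i x) (a y).
Proof.
move=> ->; rewrite [brk (a y) x]brk_skew opprK -[brk (a x) y]scale1r form2_linr mul1r.
by rewrite -!Jb_form.
Qed.

(** Apply [b] to [J_i x, y] - [x, J_i y] = 2 e_i h_i <x, y> z_i and pair with z_i: the derivation
    rule turns this into the hypothesis of [weights_equal] for s(x, y) = <a x, y> + <x, a y>. *)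
Lemma derivation_weight (a : 'rV[R]_m -> 'rV[R]_m) (b : 'rV[R]_k -> 'rV[R]_k) :
  (forall c x x', a (c *: x + x') = c *: a x + a x') ->
  (forall c z z', b (c *: z + z') = c *: b z + b z') ->
  (forall x y, b (brk x y) = brk (a x) y - brk (a y) x) ->
  forall i j, i != j -> forall x y,
    (h i * f2 (zb i) (b (zb i)) - h j * f2 (zb j) (b (zb j))) * f1 x y = 0.
Proof.
move=> a_lin b_lin ab.
have b0 : b 0 = 0 by have := b_lin (-1) 0 0; rewrite scaler0 addr0 scaleN1r addNr.
have b_sum (c : 'I_k -> R) : b (\sum_i c i *: zb i) = \sum_i c i *: b (zb i).
  by elim/big_rec2: _ => [|i x y _ <-]; [exact: b0 | exact: b_lin].
have aN x : a (- x) = - a x.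
  have a0 : a 0 = 0 by have := a_lin (-1) 0 0; rewrite scaler0 addr0 scaleN1r addNr.
  by rewrite -[- x]addr0 -scaleN1r a_lin a0 addr0 scaleN1r.
have b_brk_sum i x y : f2 (zb i) (b (brk x y)) =
    \sum_l h l * f1 (Jb l x) y * f2 (zb i) (b (zb l)).
  rewrite [brk x y]zb_expand b_sum form2_sumr.
  by apply: eq_bigr => l _; rewrite -Jb_form.
apply: (weights_equal form1_linl form1C Jb_skew Jb_anti J_zb e_sqr
  (rho := fun i => h i * f2 (zb i) (b (zb i))) (s := fun x y => f1 (a x) y + f1 x (a y))) => [x y|i x y].
  by rewrite !aN !(formNl form1_linl) !(formNr form1_linl form1C) !opprK.
have : f2 (zb i) (b (brk (Jb i x) y)) - f2 (zb i) (b (brk x (Jb i y))) =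
    2 * (h i * f2 (zb i) (b (zb i))) * e i * f1 x y.
  (* For [l] other than [i] the two terms agree because [Jb l] and [Jb i] anticommute; for [l = i]
     they are opposite, whence the factor 2. *)
  rewrite !b_brk_sum -sumrB (bigD1 i) //= big1 ?addr0 => [|l li].
    have -> : f1 (Jb i x) (Jb i y) = - e i * f1 x y.
      exact: (skew_isom form1_linl form1C Jb_skew J_zb).
    rewrite /Jb J_zb (formZl form1_linl); ring.
  have -> : f1 (Jb l x) (Jb i y) = f1 (Jb l (Jb i x)) y.
    by rewrite Jb_anti // (formNl form1_linl) [f1 (Jb i _) _]Jb_skew opprK.
  by rewrite subrr.
rewrite !(derivation_form (a := a)) // => E.
have -> : f1 (a (Jb i x)) (Jb i y) = - f1 (Jb i (a (Jb i x))) y by rewrite Jb_skew opprK.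
have eE : f1 (Jb i (a x)) (Jb i y) = - e i * f1 (a x) y.
  exact: (skew_isom form1_linl form1C Jb_skew J_zb).
transitivity (e i * (f1 (a x) y + f1 x (a y)) -
    2 * (h i * f2 (zb i) (b (zb i))) * e i * f1 x y); last by ring.
rewrite -E eE /Jb J_zb (formZl form1_linl); ring.
Qed.

Lemma zb_linear_eq0 (g : 'rV[R]_k -> 'rV[R]_m) :
  (forall c u v, g (c *: u + v) = c *: g u + g v) ->
  (forall i, g (zb i) = 0) -> forall z, g z = 0.
Proof.
move=> g_lin g0 z; rewrite [z]zb_expand; elim/big_rec: _ => [|i x _ gx].
  by have := g_lin (-1) 0 0; rewrite scaler0 addr0 scaleN1r addNr.
by rewrite g_lin g0 gx scaler0 addr0.
Qed.

Let brk_linl c x x' y : brk (c *: x + x') y = c *: brk x y + brk x' y.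
Proof. by case: brk_graded. Qed.

Let brk_alt x : brk x x = 0.
Proof. by case: brk_graded. Qed.

Let brk_span z : exists s : seq ('rV[R]_m * 'rV[R]_m), z = \sum_(p <- s) brk p.1 p.2.
Proof. by case: brk_graded => _ _ _ + _; apply. Qed.

(** * Degree 1 *)

Lemma prol3_vec1_linear Y : prol brk 3 Y ->
  forall c z z', vec1 (actZ Y (c *: z + z')) = c *: vec1 (actZ Y z) + vec1 (actZ Y z').
Proof.
move=> /prolSS [[_ zlin _ pz] _] c z z'; have := zlin c z z'.
by rewrite (prol1E (pz _)) (prol1E (pz z)) (prol1E (pz z')).
Qed.

Lemma prol3_brk Y : prol brk 3 Y -> forall x z,
  vec2 (actZ (actY brk Y x) z) = brk (vec1 (actZ Y z)) x.
Proof.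
move=> /prolSS [[_ _ py pz] [_ c1 _]] x z; have := c1 isT x z.
have /prolSS [[_ _ _ pz'] _] := py x.
by rewrite (prol0E (pz' z)) (prol1E (pz z)).
Qed.

Lemma prol3_weight Y : prol brk 3 Y -> forall i j,
  h i *: Jb i (vec1 (actZ Y (zb i))) = h j *: Jb j (vec1 (actZ Y (zb j))).
Proof.
move=> pY i j; have [->//|ij] := eqVneq i j.
apply/eqP; rewrite -subr_eq0; apply/eqP/form1_nondeg => x.
set u := _ - _.
have [[_ _ py _] _] := prolSS pY.
have [a [b [_ bE a_lin b_lin ab]]] := prol2_derivation (py x).
have bx z : b z = brk (vec1 (actZ Y z)) x by rewrite -prol3_brk // bE.
(* The difference of weights is itself [f1 u x], so evaluating at [u] and [x] makes its square
   vanish. *)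
have := derivation_weight a_lin b_lin ab ij u x.
have <- : f1 u x = h i * f2 (zb i) (b (zb i)) - h j * f2 (zb j) (b (zb j)).
  by rewrite (formDl form1_linl) (formNl form1_linl) !(formZl form1_linl) !bx !Jb_form.
by move/eqP; rewrite mulf_eq0 orbb => /eqP.
Qed.

Lemma prol3_isZero Y :
  prol brk 3 Y -> (forall i, vec1 (actZ Y (zb i)) = 0) -> isZero Y.
Proof.
move=> pY Y0; have {}Y0 := zb_linear_eq0 (prol3_vec1_linear pY) Y0.
have [[_ _ py pz] [lb _ _]] := prolSS pY.
have pyy x y : actY brk (actY brk Y x) y = E1 k (vec1 (actY brk (actY brk Y x) y)).
  by have [[_ _ + _] _] := prolSS (py x) => /(_ y) /prol1E.
have T0 : forall x y, vec1 (actY brk (actY brk Y x) y) = 0.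
  apply: (sym_comm_even_eq0 form1_linl form1_nondeg Jb_skew Jb_anti J_zb e_sqr k_gt2).
    (* Symmetry of [[Y, x], y] is the derivation rule with [Y, [x, y]] = 0. *)
    move=> x y; have := lb x y.
    rewrite (prol1E (pz _)) Y0 (pyy x y) (pyy y x) /= scaleN1r => /esym /eqP.
    by rewrite subr_eq0 => /eqP.
  move=> i j ij x y.
  have [a [b [aE bE _ _ ab]]] := prol2_derivation (py x).
  rewrite !aE /=.
  (* The derivation [Y, x] kills n_{-2}, since [[Y, x], z] = [[Y, z], x] = 0; paired with z_l, its
     derivation rule is the hypothesis of [comm_even]. *)
  apply: (comm_even form1_linl form1C form1_nondeg Jb_skew Jb_anti J_zb e_sqr) => // l w w'.
  have := derivation_form l (ab w w').
  have -> : b (brk w w') = 0.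
    have := prol3_brk pY x (brk w w'); rewrite bE Y0 /= => ->; exact: brk0l.
  rewrite form2_0r Jb_skew => /esym /eqP; rewrite addrC subr_eq0 => /eqP //.
apply: (prol_isZero_of_actY brk_linl brk_alt brk_span pY) => x.
apply: (prol_isZero_of_actY brk_linl brk_alt brk_span (py x)) => y.
by rewrite pyy T0.
Qed.

(** * Degree 3, and rigidity *)

Lemma prol5_isZero X : prol brk 5 X -> isZero X.
Proof.
move=> pX; have [[_ zlin py pz] [_ c1 c2]] := prolSS pX.
have pz1 z z' : actZ (actZ X z) z' = E1 k (vec1 (actZ (actZ X z) z')).
  by have [[_ _ _ +] _] := prolSS (pz z) => /(_ z') /prol1E.
have S0 i j : vec1 (actZ (actZ X (zb i)) (zb j)) = 0.
  apply: (sym_proportional_eq0 form1_linl form1_nondeg Jb_skew Jb_anti J_zb e_sqr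
    (S := fun i j => vec1 (actZ (actZ X (zb i)) (zb j))) k_gt2 zb_norm_sqr).
    by move=> {}i {}j; have := c2 isT (zb i) (zb j); rewrite pz1 [in X in _ X]pz1.
  by move=> {}i {}j r; apply: prol3_weight.
have Z0 z : isZero (actZ X z).
  apply: prol3_isZero => // i; move: z.
  apply: (zb_linear_eq0 (g := fun z => vec1 (actZ (actZ X z) (zb i)))) => [c u v|j]; last exact: S0.
  have := zlin c u v.
  (* [actZ X] is linear only up to [elEq], so its values are unfolded to compare their actions on
     [zb i]. *)
  have [f [g [Eg _]]] := pz (c *: u + v); have [fu [gu [Eu _]]] := pz u.
  have [fv [gv [Ev _]]] := pz v; rewrite Eg Eu Ev /= => -[_ /(_ (zb i))].
  have := pz1 (c *: u + v) (zb i); have := pz1 u (zb i); have := pz1 v (zb i).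
  by rewrite Eg Eu Ev /= => -> -> ->.
have zf x : isZero (actY brk X x).
  have [[_ _ pyy _] [_ c1' _]] := prolSS (py x).
  apply: (prol_isZero_of_actY brk_linl brk_alt brk_span (py x)) => y.
  (* The element [[X, x], y] has degree 1 and kills each z_i: as n_{-2} is central, [[[X, x], y],
     z_i] = [[[X, z_i], x], y] = 0. *)
  apply: (prol3_isZero (pyy y)) => i.
  have : isZero (actZ (actY brk (actY brk X x) y) (zb i)).
    apply: elEq_isZero (c1' isT y (zb i)) _; apply: isZero_actY brk_linl _ _ _.
    by apply: elEq_isZero (c1 isT x (zb i)) _; apply: isZero_actY.
  have [[_ _ _ pzz] _] := prolSS (pyy y).
  by rewrite (prol1E (pzz _)).
exact: (prol_isZero_of_actY brk_linl brk_alt brk_span pX).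
Qed.

End PseudoJ.

Theorem theorem4p3 (R : realType) (m k : nat)
    (brk : 'rV[R]_m -> 'rV[R]_m -> 'rV[R]_k)
    (G : 'M[R]_(m + k))
    (J : 'rV[R]_k -> 'rV[R]_m -> 'rV[R]_m) :
  graded_2step brk ->
  Mtype_form G ->
  Jmap G brk J ->
  pseudo_Jtype G J ->
  general_J2 G J ->
  (3 <= k)%N ->
  rigid brk.
Proof.
move=> brk_graded G_M J_G [zb [zb_rank zb_orth zb_norm zb_sqr]] J_J2 k3.
have sqr i : exists c : R, c * c = 1 /\ forall x, J (zb i) (J (zb i) x) = c *: x.
  case: (zb_sqr i) => Ji.
    by exists 1; split=> [|x]; rewrite ?mulr1 ?scale1r.
  by exists (-1); split=> [|x]; rewrite ?mulrNN ?mulr1 ?scaleN1r.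
have [e eP] := fin_all_exists sqr.
have [brk_linl _ brk_alt brk_span _] := brk_graded.
(* Index 5 stands for degree 3. *)
exists 5; apply: (prol_isZero_above brk_linl brk_alt brk_span).
apply: (prol5_isZero brk_graded G_M J_G zb_rank zb_orth zb_norm (e := e)) => //.
- by move=> i; case: (eP i).
- by move=> i; case: (eP i).
Qed.
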